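(* Let $r$ be a positive integer and let $\epsilon>0$. Then there exists a constant $\kappa=\kappa(r,\epsilon)>0$, depending only on $r$ and $\epsilon$, such that the following holds. For every integer $n\ge 2$ there exist $k\le \kappa\ln n$ linear forms $\ell_1,\ldots,\ell_k:\mathbb{R}^n\to\mathbb{R}$ such that, writing the homogeneous polynomial $$\tilde h_r(\mathbf{x})=\sum_{i=1}^k \ell_i(\mathbf{x})^r=\sum_{\substack{\alpha_1,\ldots,\alpha_n\ge 0\\ \alpha_1+\cdots+\alpha_n=r}}\tilde h_{r,a}\,\mathbf{x}^a$$ in the monomial basis, one has $$(1-\epsilon)^r\le \tilde h_{r,a}\le (1+\epsilon)^r$$ for all non-negative integer vectors $a=(\alpha_1,\ldots,\alpha_n)$ with $\alpha_1+\cdots+\alpha_n=r$.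
   Context: For $\mathbf{x}=(x_1,\ldots,x_n)$ and a non-negative integer vector $a=(\alpha_1,\ldots,\alpha_n)$, $\mathbf{x}^a=x_1^{\alpha_1}\cdots x_n^{\alpha_n}$. A linear form is a homogeneous linear function $\mathbb{R}^n\to\mathbb{R}$. *)

(* Defs.v *)
From mathcomp Require Export all_boot all_order all_algebra.
From mathcomp Require Export reals exp.
(* The notations of mpoly clash with those of mathcomp-analysis: they are left
   out, and the ones needed here are declared again. *)
From mathcomp Require Export -(notations) mpoly.

Notation "{ 'mpoly' T [ n ] }" := (mpoly n T)
  (at level 0, T, n at level 2, format "{ 'mpoly'  T [ n ] }") : type_scope.
Notation "p @_ a" := (mcoeff a p)
  (at level 3, a at level 2, left associativity, format "p @_ a") : ring_scope.
Notation "p .@[ v ]" := (meval v p)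
  (at level 1, left associativity, format "p .@[ v ]") : ring_scope.
Notation "d .-homog" := (ishomog1 d mdeg)
  (at level 1, format "d .-homog") : form_scope.

(* Main.v *)
(* If X_1, ..., X_n are independent exponential variables, the expected
   coefficient of x^a in (X_1 x_1 + ... + X_n x_n)^r is r!/a! * prod a_j! = r!,
   the same for every monomial. Replacing the exponential law by a finitely
   supported law with nearly the same first r moments makes the coefficients
   bounded, so by a Chernoff bound the average over k independent draws is
   within a factor 1 +- 2 delta of the common value r! for a fixed monomial,
   except with probability exp(-c k). There are at most n^r monomials, whence
   k = O(ln n) draws suffice; a final scaling of the forms normalises the
   coefficients. *)
Require Import Defs.
From HB Require Import structures.
From mathcomp Require Import sequences ring lra zify.
Import Order.TTheory GRing.Theory Num.Theory.
Local Open Scope ring_scope.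


(** * Exponential potentials and concentration *)

Lemma expR_le_quadratic (R : realType) (x : R) :
  `|x| <= 2^-1 -> expR x <= 1 + x + 2 * x ^+ 2.
Proof.
rewrite ler_norml => /andP[xl xr].
have x1 : 0 < 1 - x by lra.
have /(le_trans (expR_ge1Dx (- x))) : expR (- x) <= (expR x)^-1 by rewrite expRN.
rewrite -lef_pV2 ?posrE ?invr_gt0 ?expR_gt0 // invrK => /le_trans; apply.
(* The product [(1 + x + 2x^2)(1 - x)] equals [1 + x^2 (1 - 2x)], which is at least 1 for
   [x <= 1/2]. *)
rewrite -[leLHS]mul1r ler_pdivrMr //; nra.
Qed.

Lemma exists_le_average (R : realType) (T : finType) (W F : T -> R) (A : R) :
  (forall t, 0 <= W t) -> \sum_t W t = 1 -> \sum_t W t * F t <= A ->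
  exists t, F t <= A.
Proof.
move=> W0 W1 WF.
case: (boolP [exists t, F t <= A]) => [/existsP //|/existsPn Fgt].
have FA t : 0 < F t - A by rewrite subr_gt0 ltNge Fgt.
have nonneg t : true -> 0 <= W t * (F t - A) by rewrite mulr_ge0 ?W0 ?ltW.
have /eqP : \sum_t W t * (F t - A) = 0.
  apply/eqP; rewrite eq_le sumr_ge0 // andbT.
  under eq_bigr do rewrite mulrBr.
  by rewrite sumrB -mulr_suml W1 mul1r subr_le0.
rewrite psumr_eq0 // => /allP WF0.
suff : \sum_t W t = 0 by rewrite W1 => /eqP; rewrite oner_eq0.
apply: big1 => t _; have /implyP/(_ isT) := WF0 t (mem_index_enum t).
by rewrite mulf_eq0 (gt_eqF (FA t)) orbF => /eqP.
Qed.

(* Derandomised Chernoff bound: the exponential potential shrinks on average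
   by [rho] at each draw, so some draw achieves this. *)
Lemma exists_small_potential (R : realType) (T H : finType) (W : T -> R)
    (Z : H -> T -> R) (rho : R) :
  (forall t, 0 <= W t) -> \sum_t W t = 1 ->
  (forall h, \sum_t W t * expR (Z h t) <= rho) ->
  forall k, exists w : 'I_k -> T,
    \sum_h expR (\sum_(i < k) Z h (w i)) <= #|H|%:R * rho ^+ k.
Proof.
move=> W0 W1 Wrho.
have rho0 (h : H) : 0 <= rho.
  by apply: le_trans (Wrho h); rewrite sumr_ge0 // => t _; rewrite mulr_ge0 ?expR_ge0.
elim=> [|k [w wle]].
  have w : 'I_0 -> T by case.
  exists w; under eq_bigr do rewrite big_ord0 expR0.
  by rewrite sumr_const expr0 mulr1.
have [t tle] : exists t, \sum_h expR (Z h t + \sum_(i < k) Z h (w i))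
    <= #|H|%:R * rho ^+ k.+1.
  apply: (exists_le_average _ _ W) => //.
  under eq_bigr do rewrite mulr_sumr.
  rewrite exchange_big /=.
  apply: (@le_trans _ _ (\sum_h rho * expR (\sum_(i < k) Z h (w i)))).
    apply: ler_sum => h _.
    under eq_bigr do rewrite expRD mulrA.
    by rewrite -mulr_suml ler_wpM2r ?expR_ge0.
  (* Nonnegativity of [rho] is read off from some [h], so the empty [H], where both sides vanish, is
     treated apart. *)
  case: (pickP H) => [h _|H0].
    by rewrite -mulr_sumr exprS mulrCA ler_wpM2l ?(rho0 h).
  by rewrite big_pred0 // (eq_card0 H0) mul0r.
exists (fun i => oapp w t (unlift ord0 i)).
under eq_bigr do rewrite big_ord_recl unlift_none.
by under eq_bigr do under [X in _ + X]eq_bigr do rewrite liftK.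
Qed.

(** Both tails go into one potential indexed by [H * bool], the boolean giving the sign of the
    deviation. Once the total potential is below 1, every exponent is negative, which bounds all
    deviations at once. *)
Lemma exists_concentrated_sample (R : realType) (T H : finType) (W : T -> R)
    (Y : H -> T -> R) (delta M : R) :
  0 < delta -> delta <= 1 -> 1 <= M ->
  (forall t, 0 <= W t) -> \sum_t W t = 1 ->
  (forall h t, 0 <= Y h t <= M) ->
  (forall h, 1 - delta <= \sum_t W t * Y h t <= 1) ->
  forall k : nat,
  (#|H| * 2)%:R * expR (- (delta ^+ 2 / (72 * M ^+ 2))) ^+ k < 1 ->
  exists w : 'I_k -> T, forall h,
    `|\sum_(i < k) Y h (w i) - k%:R| <= 2 * delta * k%:R.
Proof.
move=> d0 d1 M1 W0 W1 Y0M Ymean k kbig.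
(* With increments bounded by [3 * M], this value makes the second-order cost
   [18 * lam ^+ 2 * M ^+ 2] half of the first-order gain [lam * delta]. *)
pose lam := delta / (36 * M ^+ 2).
have lam0 : 0 < lam by rewrite divr_gt0 // mulr_gt0 // exprn_gt0 //; lra.
have lamE : lam * (36 * M ^+ 2) = delta.
  by rewrite divfK // gt_eqF // mulr_gt0 // exprn_gt0 //; lra.
pose s (b : bool) : R := if b then 1 else -1.
pose Z (h : H * bool) t := lam * (s h.2 * (Y h.1 t - 1) - 2 * delta).
have Zexp h : \sum_t W t * expR (Z h t) <= expR (- (delta ^+ 2 / (72 * M ^+ 2))).
  case: h => h b; rewrite /Z /=.
  set B := fun t => s b * (Y h t - 1) - 2 * delta.
  have Bn t : `|B t| <= 3 * M.
    have /andP[y0 yM] := Y0M h t.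
    by rewrite ler_norml /B /s; case: b {B}; apply/andP; split; lra.
  (* The mean of [Y h] is within [delta] of 1, so the margin [2 * delta] leaves a drift of at most
     [- delta] for either sign. *)
  have EB : \sum_t W t * B t <= - delta.
    rewrite (eq_bigr (fun t => s b * (W t * Y h t) - (s b + 2 * delta) * W t)).
      by rewrite sumrB -!mulr_sumr W1; have /andP[] := Ymean h; rewrite /s; case: b {B Bn}; lra.
    by move=> t _; rewrite /B; ring.
  apply: (@le_trans _ _ (1 - delta ^+ 2 / (72 * M ^+ 2))); last exact: expR_ge1Dx.
  apply: (@le_trans _ _ (\sum_t (W t * (1 + 18 * lam ^+ 2 * M ^+ 2) + lam * (W t * B t)))).
    apply: ler_sum => t _.
    have -> : W t * (1 + 18 * lam ^+ 2 * M ^+ 2) + lam * (W t * B t)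
        = W t * (1 + lam * B t + 2 * (lam ^+ 2 * (3 * M) ^+ 2)) by ring.
    rewrite -[X in expR X]/(lam * B t).
    rewrite ler_wpM2l //; apply: (le_trans (expR_le_quadratic _ _ _)).
      rewrite normrM gtr0_norm //.
      apply: (@le_trans _ _ (lam * (3 * M))); first by rewrite ler_wpM2l // (ltW lam0).
      have : lam * M <= lam * M ^+ 2 by rewrite ler_wpM2l ?(ltW lam0) // expr2 ler_peMl //; lra.
      lra.
    rewrite lerD2l ler_wpM2l // exprMn ler_wpM2l ?sqr_ge0 //.
    by rewrite -[X in X <= _]real_normK ?num_real // lerXn2r ?nnegrE //; lra.
  rewrite big_split /= -mulr_suml W1 mul1r -mulr_sumr.
  have : lam * \sum_t W t * B t <= lam * - delta by rewrite ler_wpM2l // ltW.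
  have -> : delta ^+ 2 / (72 * M ^+ 2) = lam * delta / 2.
    by rewrite /lam; field; lra.
  have -> : 18 * lam ^+ 2 * M ^+ 2 = lam * delta / 2 by rewrite -lamE; field.
  lra.
have [w wle] := exists_small_potential _ _ _ W Z _ W0 W1 Zexp k.
have wneg h : \sum_(i < k) Z h (w i) < 0.
  rewrite -expR_lt1; apply: le_lt_trans kbig.
  rewrite card_prod card_bool in wle; apply: le_trans wle.
  by rewrite (bigD1 h) //= lerDl sumr_ge0 // => *; rewrite expR_ge0.
exists w => h.
have key b : s b * (\sum_(i < k) Y h (w i) - k%:R) < 2 * delta * k%:R.
  rewrite -subr_lt0 -(pmulr_rlt0 _ lam0); apply: le_lt_trans (wneg (h, b)).
  rewrite le_eqVlt; apply/orP; left; apply/eqP.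
  by rewrite -mulr_sumr sumrB -mulr_sumr sumrB !sumr_const card_ord mulr_natr.
rewrite ler_norml; have := key true; have := key false; rewrite /s.
by move=> ? ?; apply/andP; split; lra.
Qed.


(** * Binomial sums and a discrete substitute for the exponential law *)

(** Classifies the subsets of size [a + s + 1] of [{0, ..., N}] by their element [j] having exactly
    [a] smaller ones; the induction uses Pascal's rule. *)
Lemma sum_bin_mul_bin (N a s : nat) :
  (\sum_(j < N.+1) 'C(j, a) * 'C(N - j, s) = 'C(N.+1, a + s.+1))%N.
Proof.
elim: N a => [|N IHN] [|a].
- by rewrite big_ord1 subnn bin0 mul1n add0n binS !bin0n.
- by rewrite big_ord1 bin0n mul0n bin_small // addnS.
- rewrite big_ord_recl bin0 mul1n subn0 add0n binS addnC -[s.+1]add0n -IHN.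
  by congr (_ + _)%N; apply: eq_bigr => i _; rewrite !bin0 subSS.
rewrite big_ord_recl bin0n mul0n add0n.
under eq_bigr do rewrite lift0 binS subSS mulnDl.
by rewrite big_split /= !IHN addSn binS.
Qed.

Lemma sum_shifted_bin_mul_bin (N a s : nat) :
  (\sum_(j < N.+1) 'C(j + a, a) * 'C(N - j, s) = 'C(N.+1 + a, a + s.+1))%N.
Proof.
rewrite addSn addnC -sum_bin_mul_bin -addnS big_split_ord /=.
rewrite [X in _ = (X + _)%N]big1 ?add0n => [|i _]; last by rewrite bin_small ?mul0n.
by apply: eq_bigr => i _; rewrite addnC subnDl.
Qed.

(** Powers are compared with rising factorials here and with falling ones next, because the binomial
    sums above evaluate moments of the latter exactly. *)
Lemma expn_le_fact_mul_bin (j a : nat) : (j ^ a <= a`! * 'C(j + a, a))%N.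
Proof.
rewrite mulnC bin_ffact; elim: a => [|a IHa]; first by rewrite ffactn0.
by rewrite addnS ffactSS expnS leq_mul // -addnS leq_addr.
Qed.

Lemma fact_mul_bin_le_expn (j a : nat) : (a`! * 'C(j, a) <= j ^ a)%N.
Proof.
rewrite mulnC bin_ffact; elim: a => [|a IHa]; first by rewrite ffactn0.
by rewrite ffactnSr expnSr leq_mul // leq_subr.
Qed.

(** Raising [a] by one multiplies the binomial by [(N + a + 2) / (a + s + 2)], at most
    [(N + 1 + r) / (s + 2)] while [a < r]. *)
Lemma bin_shift_le (N s r a : nat) : (a <= r)%N ->
  ('C(N.+1 + a, a + s.+1) * s.+2 ^ a <= 'C(N.+1, s.+1) * (N.+1 + r) ^ a)%N.
Proof.
elim: a => [|a IHa] ar; first by rewrite addn0 add0n.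
have e := mul_bin_diag (N.+1 + a.+1) (a + s.+1).
rewrite addnS /= in e; rewrite addnS addSn !expnSr.
have {}IHa := IHa (ltnW ar).
apply: (@leq_trans ((N.+1 + a).+1 * 'C(N.+1 + a, a + s.+1) * s.+2 ^ a)).
  rewrite e (mulnC (a + s.+1).+1) -!mulnA leq_mul // mulnC leq_mul //; lia.
apply: (@leq_trans ((N.+1 + r) * ('C(N.+1 + a, a + s.+1) * s.+2 ^ a))).
  by rewrite -mulnA leq_mul //; lia.
by rewrite mulnC [leqRHS]mulnA leq_mul.
Qed.

Lemma bin_shift_ge (N s r a : nat) : (a <= r)%N ->
  ('C(N.+1, s.+1) * (N - s - r) ^ a <= 'C(N.+1, a + s.+1) * (s.+1 + r) ^ a)%N.
Proof.
elim: a => [|a IHa] ar; first by rewrite add0n.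
have e := mul_bin_left N.+1 (a + s.+1).
rewrite addSn !expnSr.
have {}IHa := IHa (ltnW ar).
apply: (@leq_trans ('C(N.+1, a + s.+1) * (s.+1 + r) ^ a * (N - s - r))).
  by rewrite mulnA leq_mul.
apply: (@leq_trans ((N.+1 - (a + s.+1)) * 'C(N.+1, a + s.+1) * (s.+1 + r) ^ a)).
  by rewrite mulnC -[leqRHS]mulnA leq_mul //; lia.
by rewrite -e (mulnC (a + s.+1).+1) -mulnA leq_mul // mulnC leq_mul //; lia.
Qed.

(** For [N = s ^ 2] the growth factors of the two binomial bounds, [(N - s - r) / (s + 1 + r)] and
    [(N + 1 + r) / (s + 2)], are both [s + O(1)], so their ratio exceeds [rho] for large [s]. *)
Lemma discretization_error (R : realType) (s r rho : R) :
  0 <= r -> r + 2 <= s -> rho <= 1 -> 3 * r + 6 <= (1 - rho) * s ->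
  rho * ((s + 1 + r) * (s * s + 1 + r)) <= (s * s - s - r) * (s + 2).
Proof.
move=> r0 rs rho1 rhos.
have h1 : (3 * r + 6) * (s * s) <= (1 - rho) * ((s + 1 + r) * (s * s + 1 + r)).
  apply: (@le_trans _ _ ((1 - rho) * s * (s * s))); first by rewrite ler_wpM2r //; nra.
  rewrite -mulrA ler_wpM2l ?subr_ge0 //.
  by apply: ler_pM; nra.
have h2 : (2 * r + 3) * s <= (r + 2) * (s * s).
  by rewrite mulrA ler_wpM2r //; nra.
have h3 : (r + 2) * (r + 2) <= s * s by apply: ler_pM; lra.
nra.
Qed.

(* The atoms [j / u], [u = (N + 1 + r) / (s + 2)], with weights
   ['C(N - j, s) / 'C(N + 1, s + 1)] form a discrete beta law, which approaches
   the exponential law as [s] grows and [N = s ^ 2]. *)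
Lemma discrete_exponential_moments (R : realType) (r : nat) (rho : R) :
  0 <= rho -> rho < 1 ->
  exists (m : nat) (w v : 'I_m -> R),
    [/\ forall j, 0 <= w j, \sum_j w j = 1, forall j, 0 <= v j
      & forall a, (a <= r)%N ->
          rho ^+ a * a`!%:R <= \sum_j w j * v j ^+ a <= a`!%:R].
Proof.
move=> rho0 rho1.
have rho1' : 0 < 1 - rho by rewrite subr_gt0.
have [s sr srho] : exists2 s, (r + 2 <= s)%N & 3 * r%:R + 6 <= (1 - rho) * s%:R.
  exists ((Num.truncn ((3 * r%:R + 6) / (1 - rho))).+1 + (r + 2))%N.
    by rewrite leq_addl.
  rewrite (mulrC (1 - rho)) -ler_pdivrMr // (le_trans (ltW (truncnS_gt _))) // ler_nat.
  by rewrite leq_addr.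
pose N := (s * s)%N.
have sN : (s + r <= N)%N by rewrite /N; nia.
pose B := 'C(N.+1, s.+1).
have B0 : 0 < (B%:R : R) by rewrite ltr0n bin_gt0; lia.
(* Scaling by the growth factor of [bin_shift_le] gives the upper bound [a!] without loss; the lower
   bound loses a factor [rho] per degree. *)
pose u : R := (N.+1 + r)%:R / s.+2%:R.
have u0 : 0 < u by rewrite divr_gt0 // ltr0n.
have rhou : rho * (s.+1 + r)%:R * u <= (N - s - r)%:R.
  have := @discretization_error R s%:R r%:R rho.
  rewrite ler0n -natrD ler_nat sr => /(_ isT isT (ltW rho1) srho) h.
  rewrite /u mulrA ler_pdivrMr ?ltr0n //.
  rewrite !natrB ?natrM; try lia.
  rewrite -(addn1 s.+1) -(addn1 s) -(addn1 N) !natrD natrM.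
  apply: le_trans (le_trans h _); rewrite le_eqVlt; apply/orP; left; apply/eqP; ring.
exists N.+1, (fun j => 'C(N - j, s)%:R / B%:R), (fun j => (j : nat)%:R / u).
split=> [j||j|a ar].
- by rewrite divr_ge0 // ler0n.
- rewrite -mulr_suml -natr_sum (eq_bigr (fun j : 'I_N.+1 => 'C(j, 0) * 'C(N - j, s)))%N.
    by rewrite sum_bin_mul_bin add0n divff // gt_eqF.
  by move=> j _; rewrite bin0 mul1n.
- by rewrite divr_ge0 ?ler0n // ltW.
pose X := (\sum_(j < N.+1) j ^ a * 'C(N - j, s))%N.
have -> : \sum_(j < N.+1) 'C(N - j, s)%:R / B%:R * ((j : nat)%:R / u) ^+ a
    = X%:R / (B%:R * u ^+ a).
  rewrite natr_sum mulr_suml; apply: eq_bigr => j _.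
  by rewrite expr_div_n natrM natrX invfM; ring.
have Xle : (X * s.+2 ^ a <= a`! * (B * (N.+1 + r) ^ a))%N.
  apply: leq_trans _ (leq_mul (leqnn _) (bin_shift_le N s _ _ ar)).
  rewrite mulnA leq_mul // -sum_shifted_bin_mul_bin big_distrr leq_sum //= => j _.
  by rewrite mulnA leq_mul // expn_le_fact_mul_bin.
have Xge : (a`! * (B * (N - s - r) ^ a) <= X * (s.+1 + r) ^ a)%N.
  apply: leq_trans (leq_mul (leqnn _) (bin_shift_ge N s _ _ ar)) _.
  rewrite mulnA leq_mul // -sum_bin_mul_bin big_distrr leq_sum //= => j _.
  by rewrite mulnA leq_mul // fact_mul_bin_le_expn.
have Bu0 : 0 < B%:R * u ^+ a by rewrite mulr_gt0 // exprn_gt0.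
apply/andP; split.
  rewrite ler_pdivlMr // -(@ler_pM2r _ ((s.+1 + r)%:R ^+ a)) ?exprn_gt0 ?ltr0n //.
  move: Xge; rewrite -(ler_nat R) natrM [X in _ <= X]natrM !natrX => /(le_trans _); apply.
  have -> : rho ^+ a * a`!%:R * (B%:R * u ^+ a) * (s.+1 + r)%:R ^+ a
     = a`!%:R * (B%:R * (rho * (s.+1 + r)%:R * u) ^+ a) by rewrite !exprMn; ring.
  rewrite natrM natrX !ler_wpM2l ?ler0n // lerXn2r // nnegrE ?ler0n //.
  exact: mulr_ge0 (mulr_ge0 rho0 (ler0n _ _)) (ltW u0).
rewrite ler_pdivrMr // /u expr_div_n !mulrA ler_pdivlMr ?exprn_gt0 ?ltr0n //.
by move: Xle; rewrite -(ler_nat R) !natrM !natrX !mulrA.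
Qed.


(** * Monomials and powers of linear forms *)

Lemma mnm_pos_decomp (n r : nat) (a : multinom n) : mdeg a = r.+1 ->
  exists (i : 'I_n) (m : multinom n),
    [/\ mdeg m = r, a = mnm_add m (mnm1 i) & forall j, a j = (m j + (i == j))%N].
Proof.
move=> ar.
have [i ai|a0] := pickP (fun i => a i != 0%N); last first.
  by move: ar; rewrite mdegE big1 // => i _; apply/eqP/negbFE/a0.
have e : a = mnm_add (mnm_sub a (mnm1 i)) (mnm1 i) by rewrite submK // lep1mP.
exists i, (mnm_sub a (mnm1 i)); split=> //.
  by move: ar; rewrite {1}e mdegD mdeg1 addn1 => -[].
by move=> j; rewrite {1}e mnmDE mnm1E.
Qed.

Definition mform (R : realType) (n : nat) (c : 'I_n -> R) : {mpoly R[n]} :=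
  \sum_j c j *: mpolyX R (mnm1 j).

Lemma mderiv_mformX (R : realType) (n r : nat) (c : 'I_n -> R) (i : 'I_n) :
  mderiv i (mform R n c ^+ r.+1) = (r.+1%:R * c i) *: mform R n c ^+ r.
Proof.
have D1 : mderiv i (mform R n c) = mpolyC n (c i).
  rewrite /mform raddf_sum (bigD1 i) //= big1 ?addr0 => [|j ji].
    rewrite mderivZ mderivX mnm1E eqxx scale1r.
    by rewrite -alg_mpolyC -mpolyX0; congr (_ *: mpolyX _ _); apply/mnmP => j; rewrite mnmBE subnn mnm0E.
  by rewrite mderivZ mderivX mnm1E (negbTE ji) scale0r scaler0.
elim: r => [|r IHr]; first by rewrite expr1 D1 expr0 mul1r alg_mpolyC.
rewrite exprS mderivM D1 IHr mul_mpolyC -scalerAr -exprS -scalerDl.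
by congr (_ *: _); rewrite -[r.+2]add1n natrD; ring.
Qed.

(** A division-free multinomial theorem: differentiating in a variable that occurs in the monomial
    lowers the degree by one and multiplies the coefficient by that variable's exponent. *)
Lemma mcoeff_mformX (R : realType) (n r : nat) (c : 'I_n -> R) (a : multinom n) :
  mdeg a = r ->
  (mform R n c ^+ r)@_a * (\prod_j (a j)`!)%:R = r`!%:R * \prod_j c j ^+ a j.
Proof.
elim: r a => [|r IHr] a.
  move/eqP; rewrite mdeg_eq0 => /eqP ->.
  rewrite expr0 mcoeff1 eqxx !big1 ?mulr1 // => j _; by rewrite mnm0E ?expr0.
move=> /mnm_pos_decomp [i [m [mr -> aE]]].
have -> : (\prod_j (mnm_add m (mnm1 i) j)`!)%N = ((m i).+1 * \prod_j (m j)`!)%N.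
  rewrite !(bigD1 i (P := xpredT)) //= mulnA mnmDE mnm1E eqxx addn1 factS; congr (_ * _)%N.
  by apply: eq_bigr => j ji; rewrite mnmDE mnm1E eq_sym (negbTE ji) addn0.
have -> : \prod_j c j ^+ mnm_add m (mnm1 i) j = c i * \prod_j c j ^+ m j.
  rewrite !(bigD1 i (P := xpredT)) //= mulrA mnmDE mnm1E eqxx addn1 exprS; congr (_ * _).
  by apply: eq_bigr => j ji; rewrite mnmDE mnm1E eq_sym (negbTE ji) addn0.
have := mcoeff_mderiv i (mform R n c ^+ r.+1) m.
rewrite mderiv_mformX mcoeffZ -[RHS]mulr_natr natrM mulrA => <-.
by rewrite -mulrA IHr // factS natrM; ring.
Qed.

Lemma meval_mform (R : realType) (n : nat) (c x : 'I_n -> R) :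
  (mform R n c).@[x] = \sum_j c j * x j.
Proof.
by rewrite /mform raddf_sum; apply: eq_bigr => j _; rewrite /= mevalZ mevalXU.
Qed.

Lemma mform_homog (R : realType) (n : nat) (c : 'I_n -> R) :
  mform R n c \is 1.-homog.
Proof. by apply: rpred_sum => j _; rewrite rpredZ // dhomogX /= mdeg1. Qed.

(* Indexing monomials by words bounds their number by [n ^ r] in the union
   bound. *)
Lemma mnm_word (n r : nat) (a : multinom n) : mdeg a = r ->
  exists g : {ffun 'I_r -> 'I_n}, forall j, a j = (\sum_(s < r) (g s == j))%N.
Proof.
elim: r a => [|r IHr] a.
  move/eqP; rewrite mdeg_eq0 => /eqP ->.
  exists [ffun s : 'I_0 => match s with Ordinal m i => False_rect _ (notF i) end].
  by move=> j; rewrite big_ord0 mnm0E.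
move=> /mnm_pos_decomp [i [m [/IHr [g mg] _ aE]]].
exists [ffun s => oapp g i (unlift ord0 s)] => j.
rewrite aE mg big_ord_recl ffunE unlift_none addnC; congr (_ + _)%N.
by apply: eq_bigr => s _; rewrite ffunE liftK.
Qed.


(** * Number of draws, sampling and normalisation *)

Definition lform (R : realType) (n : nat) (c : 'I_n -> R) (x : 'rV[R]_n) : R :=
  \sum_j c j * x 0 j.

Lemma lform_is_linear (R : realType) (n : nat) (c : 'I_n -> R) :
  scalar (lform R n c).
Proof.
move=> b x y; rewrite /lform mulr_sumr -big_split; apply: eq_bigr => j _ /=.
by rewrite !mxE; ring.
Qed.

HB.instance Definition _ (R : realType) (n : nat) (c : 'I_n -> R) :=
  GRing.isLinear.Build R 'rV[R]_n R *%R (lform R n c) (lform_is_linear R n c).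

Lemma bernoulli_inequality (R : realType) (x : R) (r : nat) :
  0 <= x <= 1 -> 1 - r%:R * x <= (1 - x) ^+ r.
Proof.
move=> /andP[x0 x1]; elim: r => [|r IHr]; first by rewrite expr0 mul0r subr0.
rewrite exprS; apply: (@le_trans _ _ ((1 - x) * (1 - r%:R * x))).
  have r0 : 0 <= r%:R :> R by rewrite ler0n.
  have : 0 <= r%:R * (x * x) by rewrite !mulr_ge0.
  by rewrite -natr1; lra.
by rewrite ler_wpM2l // subr_ge0.
Qed.

Lemma exists_ln_many_draws (R : realType) (r : nat) (c : R) : 0 < c ->
  exists2 kappa : R, 0 < kappa & forall n : nat, (2 <= n)%N ->
    exists k : nat, [/\ (0 < k)%N, k%:R <= kappa * ln (n%:R : R)
      & (n ^ r * 2)%:R * expR (- c) ^+ k < 1].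
Proof.
move=> c0.
have ln2 : 0 < ln (2 : R) by rewrite ln_gt0 // ltr1n.
have r0 : 0 < r.+1%:R / c by rewrite divr_gt0 // ltr0n.
(* The first term brings [exp(-ck)] below [n^-(r+1)], which beats [2 n^r] as [n >= 2]; the second
   pays for rounding up, since [1 <= ln n / ln 2]. *)
exists (r.+1%:R / c + (ln 2)^-1) => [|n n2]; first by rewrite addr_gt0 ?invr_gt0.
have n0 : 0 < n%:R :> R by rewrite ltr0n; lia.
have ln2n : ln 2 <= ln (n%:R : R) by rewrite ler_ln ?posrE // ler_nat.
have lnn0 : 0 < ln (n%:R : R) by apply: lt_le_trans ln2n.
set y := r.+1%:R / c * ln (n%:R : R).
have y0 : 0 <= y by rewrite mulr_ge0 ?ltW.
exists (Num.truncn y).+1; split=> //.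
  rewrite mulrDl -natr1 lerD ?truncn_le //.
  by rewrite mulrC ler_pdivlMr // mul1r.
have ygt := truncnS_gt y; rewrite -expRM_natl.
apply: (@lt_le_trans _ _ ((n ^ r * 2)%:R * expR (- (r.+1%:R * ln n%:R)))).
  rewrite ltr_pM2l ?ltr0n ?muln_gt0 ?expn_gt0; last by lia.
  rewrite ltr_expR mulrN ltrN2 -ltr_pdivrMr //.
  by rewrite mulrAC.
rewrite expRN expRM_natl lnK ?posrE // ler_pdivrMr ?exprn_gt0 // mul1r.
by rewrite -natrX ler_nat expnSr leq_mul.
Qed.

Lemma exists_approximate_moments (R : realType) (r : nat) (delta : R) :
  0 < delta -> delta <= 1 ->
  exists2 kappa : R, 0 < kappa & forall n : nat, (2 <= n)%N ->
    exists (k : nat) (c : 'I_k -> 'I_n -> R),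
      [/\ (0 < k)%N, k%:R <= kappa * ln (n%:R : R)
        & forall a : multinom n, mdeg a = r ->
          `|\sum_(i < k) \prod_j (c i j ^+ a j / (a j)`!%:R) - k%:R|
            <= 2 * delta * k%:R].
Proof.
move=> d0 d1.
(* Bernoulli then gives [(1 - x) ^+ r >= 1 - delta]; the denominator [r + 1] also covers [r = 0]. *)
pose x : R := delta / r.+1%:R.
have x01 : 0 <= x <= 1.
  rewrite divr_ge0 ?(ltW d0) ?ler0n //= ler_pdivrMr ?ltr0n // mul1r.
  by rewrite (le_trans d1) // ler1n.
have /andP[x0 x1] := x01.
have [||m [w [v [w0 w1 v0 wv]]]] := discrete_exponential_moments R r (1 - x).
- by rewrite subr_ge0.
- by rewrite ltrBlDr ltrDl divr_gt0 // ltr0n.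
pose V := 1 + \sum_j v j.
have V1 : 1 <= V by rewrite lerDl sumr_ge0.
have vV j : v j <= V.
  rewrite /V (bigD1 j) //= addrCA lerDl addr_ge0 // sumr_ge0 //.
have M1 : 1 <= V ^+ r by rewrite exprn_ege1.
have [|kappa kappa0 kappaP] :=
    exists_ln_many_draws R r (delta ^+ 2 / (72 * (V ^+ r) ^+ 2)).
  by rewrite divr_gt0 ?exprn_gt0 // mulr_gt0 // !exprn_gt0 // (lt_le_trans ltr01).
exists kappa => // n /kappaP [k [k0 kle kbig]].
(* The product law: the [n] coefficients of a form are drawn independently. *)
pose W (f : {ffun 'I_n -> 'I_m}) := \prod_j w (f j).
pose e (g : {ffun 'I_r -> 'I_n}) j := (\sum_(s < r) (g s == j))%N.
pose Y g (f : {ffun 'I_n -> 'I_m}) := \prod_j (v (f j) ^+ e g j / (e g j)`!%:R).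
have sum_e g : (\sum_j e g j = r)%N.
  rewrite exchange_big /= -[RHS]card_ord -sum1_card; apply: eq_bigr => s _.
  by rewrite (bigD1 (g s)) //= eqxx big1 // => j; rewrite eq_sym => /negbTE ->.
have e_le g j : (e g j <= r)%N by rewrite -(sum_e g) (bigD1 j) //= leq_addr.
have W0 f : 0 <= W f by apply: prodr_ge0.
have W1 : \sum_f W f = 1.
  rewrite -(bigA_distr_bigA (fun (_ : 'I_n) i => w i)) big1 // => j _.
have Y0M g f : 0 <= Y g f <= V ^+ r.
  rewrite -[in V ^+ r](sum_e g) -prodrXr; apply/andP; split.
    by apply: prodr_ge0 => j _; rewrite divr_ge0 ?exprn_ge0 ?ler0n.
  apply: ler_prod => j _; rewrite divr_ge0 ?exprn_ge0 ?ler0n //=.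
  rewrite ler_pdivrMr ?ltr0n ?fact_gt0 //.
  apply: (@le_trans _ _ (V ^+ e g j)); first by rewrite lerXn2r ?nnegrE // (le_trans _ V1).
  by rewrite ler_peMr ?ler1n ?fact_gt0 // exprn_ge0 // (le_trans _ V1).
have Ymean g : 1 - delta <= \sum_f W f * Y g f <= 1.
  (* By independence the mean factorises into one-variable moments, and the exponents [e g j] add up
     to [r], so the total loss is [(1 - x) ^+ r]. *)
  have -> : \sum_f W f * Y g f
      = \prod_j ((\sum_i w i * v i ^+ e g j) / (e g j)`!%:R).
    under [RHS]eq_bigr do rewrite mulr_suml.
    rewrite bigA_distr_bigA; apply: eq_bigr => f _.
    by rewrite -big_split; apply: eq_bigr => j _ /=; rewrite mulrA.
  have f0 a : 0 < a`!%:R :> R by rewrite ltr0n fact_gt0.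
  apply/andP; split.
    apply: (@le_trans _ _ ((1 - x) ^+ r)).
      apply: le_trans (bernoulli_inequality _ _ r x01).
      rewrite lerD2l lerN2 /x mulrCA ler_piMr ?(ltW d0) //.
      by rewrite ler_pdivrMr ?ltr0n // mul1r ler_nat.
    rewrite -[in X in X <= _](sum_e g) -prodrXr; apply: ler_prod => j _.
    rewrite exprn_ge0 ?subr_ge0 //= ler_pdivlMr //.
    by have /andP[] := wv _ (e_le g j).
  apply: prodr_ile1 => j _; rewrite ler_pdivrMr // mul1r divr_ge0 ?ler0n //=.
    by have /andP[] := wv _ (e_le g j).
  by apply: sumr_ge0 => i _; rewrite mulr_ge0 ?exprn_ge0.
have [|f fP] := exists_concentrated_sample _ _ _ W Y delta (V ^+ r) d0 d1 M1 W0 W1 Y0M Ymean k.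
  by rewrite card_ffun !card_ord.
exists k, (fun i j => v (f i j)); split=> // a /mnm_word [g ag].
have := fP g; congr (`|_ - _| <= _); apply: eq_bigr => i _.
by apply: eq_bigr => j _; rewrite ag.
Qed.

Theorem theorem1p3 (R : realType) (r : nat) (eps : R) :
  (0 < r)%N -> 0 < eps ->
  exists2 kappa : R, 0 < kappa &
    forall n : nat, (2 <= n)%N ->
    exists (k : nat) (l : 'I_k -> {scalar 'rV[R]_n}),
      k%:R <= kappa * ln (n%:R : R) /\
      exists h : {mpoly R[n]},
        [/\ h \is r.-homog,
            forall x : 'rV[R]_n,
              h.@[fun j => x 0 j] = \sum_(i < k) l i x ^+ r
          & forall a : multinom n, mdeg a = r ->
              (1 - eps) ^+ r <= h@_a <= (1 + eps) ^+ r].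
Proof.
move=> r0 eps0.
(* For [eps > 2] and even [r] the lower bound may exceed 1, so the target
   value of the coefficients is the midpoint [T] rather than 1. *)
pose A := Num.max 0 ((1 - eps) ^+ r); pose B := (1 + eps) ^+ r.
have AB : A < B.
  rewrite gt_max exprn_gt0 /=; last by lra.
  apply: (@le_lt_trans _ _ (`|1 - eps| ^+ r)); first by rewrite -normrX ler_norm.
  by rewrite ltrXn2r -?lt0n // ltr_norml; apply/andP; split; lra.
have A0 : 0 <= A by rewrite le_max lexx.
have AA : (1 - eps) ^+ r <= A by rewrite le_max lexx orbT.
(* Truncating [A] at 0 keeps the midpoint positive even when [(1 - eps) ^+ r] is negative. *)
have [T T0 [TA TB]] : exists2 T : R, 0 < T
    & A + (B - A) / 2 <= T /\ T + (B - A) / 2 <= B.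
  by exists ((A + B) / 2); [lra|split; lra].
(* A relative error [2 * delta] around [T] then stays within the half-width [(B - A) / 2]. *)
pose delta := Num.min 1 ((B - A) / (4 * T)).
have d0 : 0 < delta.
  by rewrite lt_min ltr01 divr_gt0 ?subr_gt0 // mulr_gt0.
have d1 : delta <= 1 by rewrite ge_min lexx.
have dT : T * (2 * delta) <= (B - A) / 2.
  have : delta <= (B - A) / (4 * T) by rewrite ge_min lexx orbT.
  rewrite ler_pdivlMr ?mulr_gt0 //; lra.
have [kappa kappa0 kappaP] := exists_approximate_moments R r delta d0 d1.
exists kappa => // n /kappaP [k [c [k0 kle cP]]].
have kR : 0 < k%:R :> R by rewrite ltr0n.
have rR : 0 < r`!%:R :> R by rewrite ltr0n fact_gt0.
(* Its [r]-th power cancels the [r!] of the multinomial coefficients, averages over the [k] draws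
   and moves the common value to [T]. *)
pose tau := powR (T / (k%:R * r`!%:R)) r%:R^-1.
have tauX : tau ^+ r = T / (k%:R * r`!%:R).
  rewrite -powR_mulrn ?powR_ge0 // -powRrM mulVf ?pnatr_eq0 -?lt0n //.
  by rewrite powRr1 // divr_ge0 ?ltW // mulr_gt0.
pose c' i j := tau * c i j.
exists k, (fun i => lform R n (c' i)); split=> //.
exists (\sum_i mform R n (c' i) ^+ r); split.
- apply: rpred_sum => i _.
  by have /dhomogMn -/(_ r) := mform_homog R n (c' i); rewrite mul1n.
- move=> x; rewrite raddf_sum; apply: eq_bigr => i _ /=.
  by rewrite rmorphXn /= meval_mform.
move=> a ar.
have coefE : (\sum_i mform R n (c' i) ^+ r)@_a
    = T / k%:R * \sum_(i < k) \prod_j (c i j ^+ a j / (a j)`!%:R).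
  rewrite raddf_sum mulr_sumr; apply: eq_bigr => i _ /=.
  have a0 : 0 < (\prod_j (a j)`!)%:R :> R.
    by rewrite ltr0n prodn_gt0 // => j; rewrite fact_gt0.
  apply: (mulIf (lt0r_neq0 a0)); rewrite mcoeff_mformX //.
  rewrite /c'; under eq_bigr do rewrite exprMn.
  rewrite big_split /= prodrXr -mdegE ar tauX natr_prod.
  rewrite -!mulrA -big_split /=.
  under [in RHS]eq_bigr do rewrite divfK ?pnatr_eq0 -?lt0n ?fact_gt0 //.
  by rewrite invfM mulrCA; field; lra.
have := cP a ar; rewrite coefE.
set S := \sum_(i < k) _ => SP.
have : `|T / k%:R * S - T| <= T * (2 * delta).
  have -> : T / k%:R * S - T = T / k%:R * (S - k%:R) by field; lra.
  rewrite normrM gtr0_norm ?(divr_gt0 T0 kR) // mulrAC ler_pdivrMr // -mulrA.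
  by rewrite ler_wpM2l ?(ltW T0).
rewrite ler_norml => /andP[h1 h2].
by apply/andP; split; [apply: le_trans AA _|]; rewrite -?/B; lra.
Qed.
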